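(* Let $R$ be an exceptional simple ring, and let $A$ be a noncentral additive subgroup of $R$ (i.e. $A\not\subseteq Z(R)$). Then $\big[A,[R,R]\big]\subseteq A$ if and only if either $Z(R)\subseteq A\subseteq [R,R]$ or $[R,R]\subseteq A$.
   Context: Rings are associative, not necessarily unital; $Z(R)$ is the center of $R$. A ring $R$ is simple if $R^2\neq 0$ and its only ideals are $0$ and $R$. $[a,b]:=ab-ba$; for additive subgroups $A,B$ of $R$, $[A,B]$ is the additive subgroup generated by all $[a,b]$, $a\in A$, $b\in B$. For a prime ring $R$, let $Q_s(R)$ be its Martindale symmetric ring of quotients and $C$ (the extended centroid) the center of $Q_s(R)$, which is a field; $RC$ is the additive subgroup of $Q_s(R)$ generated by all products $rc$, $r\in R$, $c\in C$. $R$ is called exceptional if both $\mathrm{char}\,R=2$ and $\dim_C RC=4$. For an exceptional simple ring one has $C=Z(R)$ and $RC=R$, so exceptional means: $\mathrm{char}\,R=2$ and $\dim_{Z(R)}R=4$. *)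

(* Defs.v *)
From HB Require Import structures.
From mathcomp Require Import all_boot all_algebra.
From mathcomp Require Import boolp classical_sets.

Set Implicit Arguments.
Unset Strict Implicit.
Unset Printing Implicit Defensive.

Import GRing.Theory.
Local Open Scope classical_set_scope.
Local Open Scope ring_scope.

(** Associative rings, not necessarily unital: MathComp's [pzRingType] and its
    descendants all have a unit. *)
HB.mixin Record Zmodule_isRng R of GRing.Zmodule R := {
  rmul : R -> R -> R;
  rmulA : associative rmul;
  rmulDl : left_distributive rmul +%R;
  rmulDr : right_distributive rmul +%R
}.

#[short(type="rngType")]
HB.structure Definition Rng := {R of Zmodule_isRng R & GRing.Zmodule R}.

Declare Scope rng_scope.
Delimit Scope rng_scope with rng.
Notation "x ** y" := (rmul x y) (at level 40, left associativity) : rng_scope.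
Local Open Scope rng_scope.

Definition additive_subgroup (V : zmodType) (A : set V) : Prop :=
  A 0 /\ forall x y, A x -> A y -> A (x - y).

Definition additive_closure (V : zmodType) (S : set V) : set V :=
  smallest (@additive_subgroup V) S.

Definition ideal (R : rngType) (I : set R) : Prop :=
  additive_subgroup I /\ forall r x, I x -> I (r ** x) /\ I (x ** r).

(** The first conjunct is [R^2 <> 0]. *)
Definition simple_ring (R : rngType) : Prop :=
  (exists x y : R, x ** y <> 0) /\
  forall I : set R, ideal I -> I = [set 0] \/ I = setT.

Definition center (R : rngType) : set R :=
  [set z | forall x, z ** x = x ** z].

(** [Lie A B] is [[A, B]]: the additive subgroup generated by the commutators,
    not just the set of commutators. *)
Definition Lie (R : rngType) (A B : set R) : set R :=
  additive_closure [set a ** b - b ** a | a in A & b in B].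

(** Without a unit, [char R] is the nonnegative generator of the ideal of
    integers annihilating all of [R]. *)
Definition has_char (R : rngType) (p : nat) : Prop :=
  forall m : nat, (forall x : R, x *+ m = 0) <-> (p %| m)%N.

(** [f : J -> R] is a homomorphism of right (resp. left) [R]-modules; only the
    restriction of the total function [f] to [J] matters. *)
Definition right_module_map (R : rngType) (J : set R) (f : R -> R) : Prop :=
  (forall x y, J x -> J y -> f (x + y) = f x + f y) /\
  (forall x r, J x -> f (x ** r) = f x ** r).

Definition left_module_map (R : rngType) (J : set R) (g : R -> R) : Prop :=
  (forall x y, J x -> J y -> g (x + y) = g x + g y) /\
  (forall r x, J x -> g (r ** x) = r ** g x).

(** [Q], with the embedding [iota], is the Martindale symmetric ring of
    quotients of the prime ring [R]. The four-part description below determines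
    [(Q, iota)] up to a unique isomorphism over [R]; its last clause says that
    every compatible pair [(f, g)] on a nonzero ideal is given by left and
    right multiplication by an element of [Q]. (For rings that are not prime
    one would have to use essential ideals instead of nonzero ones.) *)
Definition symmetric_quotient_ring (R : rngType) (Q : nzRingType)
    (iota : {additive R -> Q}) : Prop :=
  [/\ injective iota /\ {morph iota : x y / x ** y >-> x * y},
      forall q : Q, exists J : set R, [/\ ideal J, J <> [set 0] &
        forall x, J x ->
          range iota (q * iota x) /\ range iota (iota x * q)],
      forall (q : Q) (J : set R), ideal J -> J <> [set 0] ->
        (forall x, J x -> q * iota x = 0) \/
        (forall x, J x -> iota x * q = 0) -> q = 0 &
      forall (J : set R) (f g : R -> R), ideal J -> J <> [set 0] ->
        right_module_map J f -> left_module_map J g ->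
        (forall x y, J x -> J y -> x ** f y = g x ** y) ->
        exists q : Q, forall x, J x ->
          q * iota x = iota (f x) /\ iota x * q = iota (g x)].

(** The center of a unital ring; for [Q] as above, the extended centroid. *)
Definition unital_center (Q : nzRingType) : set Q :=
  [set c | forall q, GRing.comm c q].

(** [RC], for [C] the center of [Q]. *)
Definition central_closure (R : rngType) (Q : nzRingType)
    (iota : {additive R -> Q}) : set Q :=
  additive_closure [set iota r * c | r in setT & c in @unital_center Q].

(** [V] is an [n]-dimensional [K]-space: it has a [K]-basis of size [n]. [K] is
    meant to be a subfield of [Q] and [V] a [K]-subspace of [Q]. *)
Definition has_dim (Q : nzRingType) (K V : set Q) (n : nat) : Prop :=
  exists e : 'I_n -> Q,
    [/\ forall i, V (e i),
        forall v, V v -> exists c : 'I_n -> Q,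
          (forall i, K (c i)) /\ v = \sum_i c i * e i &
        forall c : 'I_n -> Q, (forall i, K (c i)) ->
          \sum_i c i * e i = 0 -> forall i, c i = 0].

(** The pair [(Q, iota)] being unique up to isomorphism, quantifying it
    existentially or universally makes no difference. *)
Definition exceptional (R : rngType) : Prop :=
  exists (Q : nzRingType) (iota : {additive R -> Q}),
    [/\ symmetric_quotient_ring iota, has_char R 2 &
        has_dim (@unital_center Q) (central_closure iota) 4].

(* Main.v *)
(** [C] is a field [F] over which [R] is 4-dimensional, and right
    multiplications embed [R] in the 4 x 4 matrices over [F]; being prime and
    finite-dimensional, the image has a unit, so [R] is a central simple
    [F]-algebra. If [ad a] has rank at most 1 then [a] is central, so a
    noncentral [a] has the 2-dimensional centralizer [F + Fa]. In particular
    every element is quadratic over [F], and not all noncentral squares are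
    scalar, which gives [u] with [u^2 = u + k]. Then [ad u] is idempotent, and
    primeness yields [v] with [ad u v = v] and [v^2 = l <> 0] in [F]; hence
    [1, u, v, uv] span [R].

    In these coordinates [[R, R]] is [F + Fv + Fuv], and its elements commute
    modulo [F]. If [a] in [[R, R]] is noncentral, then [[a, [R, R]] = F]. If
    [a] is outside [[R, R]], then [ad a] acts on [[R, R] / F] as a nonzero
    scalar, so that [[R, R] = [a, [R, R]] + F]. Both implications follow. *)

Require Import Defs.
From HB Require Import structures.
From mathcomp Require Import all_boot all_algebra falgebra.
From mathcomp Require Import boolp classical_sets.

Set Implicit Arguments.
Unset Strict Implicit.
Unset Printing Implicit Defensive.

Import GRing.Theory.
Local Open Scope ring_scope.
Local Open Scope classical_set_scope.

(** * Four-dimensional central prime algebras in characteristic 2 *)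

Section Ad.
Variables (F : fieldType) (A : falgType F).
Implicit Types a b c x y : A.

Definition ad a : 'End(A) := amull a - amulr a.

Lemma adE a x : ad a x = a * x - x * a.
Proof. by rewrite /ad add_lfunE opp_lfunE !lfunE. Qed.

Lemma ad_eq0 a x : (ad a x == 0) = (a * x == x * a).
Proof. by rewrite adE subr_eq0. Qed.

Lemma adP a x : reflect (a * x = x * a) (ad a x == 0).
Proof. by rewrite ad_eq0; apply: eqP. Qed.

Lemma adC a x : ad a x = - ad x a.
Proof. by rewrite !adE opprB. Qed.

Lemma adxx a : ad a a = 0.
Proof. by rewrite adE subrr. Qed.

Lemma adx1 a : ad a 1 = 0.
Proof. by rewrite adE mulr1 mul1r subrr. Qed.

Lemma ad_mul a x y : ad a (x * y) = ad a x * y + x * ad a y.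
Proof. by rewrite !adE mulrBl mulrBr !mulrA addrA subrK. Qed.

Lemma adDl a b x : ad (a + b) x = ad a x + ad b x.
Proof. by rewrite adC linearD opprD -!adC. Qed.

Lemma adZl k a x : ad (k *: a) x = k *: ad a x.
Proof. by rewrite adC linearZ /= -scalerN -adC. Qed.

Lemma ad1x x : ad 1 x = 0.
Proof. by rewrite adC adx1 oppr0. Qed.

Lemma ad_scalar k x : ad k%:A x = 0.
Proof. by rewrite adZl ad1x scaler0. Qed.

End Ad.

Definition prime_alg (F : fieldType) (A : falgType F) : Prop :=
  forall x y : A, (forall z, x * z * y = 0) -> x = 0 \/ y = 0.

Definition central_alg (F : fieldType) (A : falgType F) : Prop :=
  forall z : A, (forall x, z * x = x * z) -> exists k : F, z = k%:A.

Section PrimeAlgebra.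
Variables (F : fieldType) (A : falgType F).
Hypothesis primeA : prime_alg A.
Implicit Types a b c w x y : A.

(** If [w' = ad a y] spans the image, the centralizer of [a] acts on its line by scalars from either
    side, so a scalar shift [b] of [a] satisfies [b * w' = 0]. Primeness excludes [w' * w' = 0],
    whence [w' * b = 0] as well. Then [ad b] kills [w' * y * w'], although its value there is
    [w' * w' * w'], a nonzero multiple of [w']. *)
Lemma ad_rank1_eq0 a w : (forall x, exists k, ad a x = k *: w) -> ad a = 0.
Proof.
move=> rk1; apply/eqP; apply: contraT => /lfunPn[y]; rewrite zero_lfunE.
set w' := ad a y => w'0.
have {}rk1 x : exists k, ad a x = k *: w'.
  have [k ek] := rk1 x; have [l el] := rk1 y.
  have l0 : l != 0 by apply: contraNneq w'0 => l0; rewrite /w' el l0 scale0r.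
  by exists (k / l); rewrite /w' el scalerA divfK.
have cw c : ad a c = 0 -> exists k, c * w' = k *: w'.
  by move=> ac; have [k] := rk1 (c * y); rewrite ad_mul ac mul0r add0r; exists k.
have wc c : ad a c = 0 -> exists k, w' * c = k *: w'.
  by move=> ac; have [k] := rk1 (y * c); rewrite ad_mul ac mulr0 addr0; exists k.
(* Shifting [a] by a scalar does not change [ad a]. *)
have [b ebw ebd] : exists2 b, b * w' = 0 & forall x, ad b x = ad a x.
  have [k ek] := cw a (adxx a); exists (a - k%:A).
    by rewrite mulrBl ek -scalerAl mul1r subrr.
  by move=> x; rewrite adDl -scaleNr ad_scalar addr0.
have ww : w' * w' != 0.
  apply: contraNneq w'0 => ww; have [] // := primeA (x := b) (y := w').
  (* Here [x] splits into [x - k *: y], which centralizes [a], and a multiple of [y]; [b * _ * w']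
     vanishes on both parts. *)
  - move=> x; have [k ek] := rk1 x.
    have [l el] : exists l, (x - k *: y) * w' = l *: w'.
      by apply: cw; rewrite linearB linearZ /= ek subrr.
    have -> : x = (x - k *: y) + k *: y by rewrite subrK.
    rewrite mulrDr mulrDl -!mulrA el -scalerAr ebw scaler0 add0r.
    have -> : b * (k *: y * w') = k *: (b * y * w').
      by rewrite -scalerAl -scalerAr mulrA.
    have -> : b * y = w' + y * b by rewrite /w' -ebd adE subrK.
    by rewrite mulrDl ww add0r -mulrA ebw mulr0 scaler0.
  - by move=> b0; rewrite /w' -ebd b0 adE mul0r mulr0 subrr.
  - by move=> ->.
have [m em] : exists m, w' * b = m *: w'.
  by apply: wc; rewrite -ebd adxx.
have m0 : m = 0.
  apply: contraNeq ww => m0; apply/eqP/(scalerI m0).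
  by rewrite scaler0 scalerAl -em -mulrA ebw mulr0.
rewrite {}m0 scale0r in em.
have [k ek] : exists k, w' * w' = k *: w'.
  by apply: cw; rewrite -ebd adE ebw em subrr.
have : ad a (w' * y * w') = w' * w' * w'.
  have aw : ad a w' = 0 by rewrite -ebd adE ebw em subrr.
  by rewrite !ad_mul aw mul0r mulr0 add0r addr0.
rewrite -ebd adE !mulrA ebw -[_ * b]mulrA em !mul0r mulr0 subrr.
rewrite ek -scalerAl ek scalerA => /esym/eqP; rewrite scaler_eq0 mulf_eq0 orbb.
by case/orP=> /eqP k0; move: ww; rewrite ek k0 ?scale0r ?scaler0 eqxx.
Qed.

Hypothesis dimA : (\dim {:A} <= 4)%N.

(** By [ad_rank1_eq0] the rank of [ad a] is at least 2, so its kernel has dimension at most 2 and is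
    spanned by the independent vectors [1] and [a]. *)
Lemma centralizer_quadratic a x :
  ad a != 0 -> ad a x = 0 -> exists k l, x = k%:A + l *: a.
Proof.
move=> a0 ax.
have rk : (2 <= \dim (limg (ad a)))%N.
  rewrite ltnNge; apply: contra a0 => rk; apply/eqP.
  pose w := vpick (limg (ad a)).
  have ew : limg (ad a) = <[w]>%VS.
    apply/esym/eqP; rewrite eqEdim -memvE memv_pick dim_vline vpick0.
    by case: eqP => [->|_] //; rewrite dimv0.
  apply: (@ad_rank1_eq0 _ w) => y; apply/vlineP; rewrite -ew.
  by rewrite memv_img ?memvf.
have rkk : (\dim (lker (ad a)) <= 2)%N.
  have := limg_ker_dim (ad a) fullv; rewrite capfv => e.
  move: dimA; rewrite -e => d; rewrite -(leq_add2r 2).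
  by apply: leq_trans d; rewrite leq_add2l.
pose X := [:: 1; a]; have fr : free X.
  rewrite free_cons seq1_free span_seq1; apply/andP; split.
    apply: contra a0 => /vlineP[k e1].
    apply/eqP/lfunP => y; rewrite zero_lfunE.
    have k0 : k != 0 by apply/eqP => k0; move/eqP: e1; rewrite k0 scale0r oner_eq0.
    have -> : a = k^-1%:A by rewrite e1 scalerA mulVf ?scale1r.
    by rewrite ad_scalar.
  by apply: contra a0 => /eqP ->; apply/eqP/lfunP => y;
    rewrite zero_lfunE adE mul0r mulr0 subrr.
have sub : (<<X>> <= lker (ad a))%VS.
  by apply/span_subvP => y; rewrite !inE => /orP[] /eqP ->;
    rewrite memv_ker ?adx1 ?adxx.
have ek : <<X>>%VS = lker (ad a).
  by apply/eqP; rewrite eqEdim sub /= (eqP (fr : _ == _)).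
have : x \in <<X>>%VS by rewrite ek memv_ker ax.
rewrite span_cons span_seq1.
by case/memv_addP=> _ /vlineP[k ->] [_ /vlineP[l ->] ->]; exists k, l.
Qed.

Hypothesis centralA : central_alg A.
Hypothesis char2A : forall x : A, x + x = 0.

Lemma char2_opp x : - x = x.
Proof. by apply/eqP; rewrite eq_sym -addr_eq0 char2A. Qed.

Lemma ad_char2 a x : ad a x = a * x + x * a.
Proof. by rewrite adE char2_opp. Qed.

Lemma ad_eq0_scalar a : ad a = 0 -> exists k, a = k%:A.
Proof. by move=> a0; apply: centralA => x; apply/adP; rewrite a0 zero_lfunE. Qed.

Lemma quadratic a : exists k l, a * a = k%:A + l *: a.
Proof.
have [/ad_eq0_scalar[k ->]|a0] := eqVneq (ad a) 0.
  exists (k * k), 0.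
  by rewrite -scalerAl mul1r scale0r addr0 scalerA.
by apply: centralizer_quadratic => //; rewrite ad_mul adxx mul0r mulr0 addr0.
Qed.

(** Polarizing squares makes every [ad b c] scalar. If [ad a b = k] were nonzero, then
    [ad a (a * b) = k *: a] would be scalar too, and [a] central. *)
Lemma ad_eq0_sqr_scalar :
  (forall a, ad a != 0 -> exists k, a * a = k%:A) -> forall a, ad a = 0.
Proof.
move=> sqs a; apply/eqP; apply: contraT => a0.
have sq b : exists k, b * b = k%:A.
  have [/ad_eq0_scalar[k ->]|/sqs//] := eqVneq (ad b) 0.
  by exists (k * k); rewrite -scalerAl mul1r scalerA.
have adk b c : exists k, ad b c = k%:A.
  have [k ek] := sq b; have [l el] := sq c; have [m em] := sq (b + c).
  exists (m - k - l); rewrite !scalerBl -ek -el -em ad_char2 mulrDl !mulrDr.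
  by rewrite -addrA -opprD [c * b + _]addrC addrACA addrC addKr.
have /lfunPn[b] := a0; rewrite zero_lfunE => ab.
have [k ek] := adk a b; have [l el] := adk a (a * b).
have k0 : k != 0 by apply: contraNneq ab => k0; rewrite ek k0 scale0r.
move: a0; rewrite ad_mul adxx mul0r add0r ek -scalerAr mulr1 in el.
have -> : a = (k^-1 * l)%:A by rewrite -scalerA -el scalerA mulVf ?scale1r.
by move/eqP; case; apply/lfunP => x; rewrite zero_lfunE ad_scalar.
Qed.

Lemma exists_artin_schreier a :
  ad a != 0 -> exists (u : A) k, ad u != 0 /\ u * u = u + k%:A.
Proof.
move=> a0; apply: contrapT => noAS; move/eqP: a0; apply.
apply: ad_eq0_sqr_scalar => b b0; have [k [l e]] := quadratic b.
have [l0|l0] := eqVneq l 0; first by exists k; rewrite e l0 scale0r addr0.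
(* Dividing the quadratic equation of [b] by [l * l] makes the linear coefficient 1. *)
case: noAS; exists (l^-1 *: b), (l^-1 * l^-1 * k); split.
  apply: contra b0 => /eqP b0; apply/eqP/lfunP => x.
  apply: (scalerI (invr_neq0 l0)).
  by rewrite -adZl b0 !zero_lfunE scaler0.
rewrite -scalerAl -scalerAr e scalerA scalerDr !scalerA addrC; congr (_ + _).
by rewrite -mulrA mulVf ?mulr1.
Qed.

Lemma exists_quaternion_basis : (exists a : A, ad a != 0) ->
  exists (u v : A) (k l : F), [/\ u * u = u + k%:A, ad u v = v,
    v * v = l%:A, l != 0 &
    forall x, exists p q r s, x = p%:A + q *: u + r *: v + s *: (u * v)].
Proof.
case=> a /exists_artin_schreier[u [k [u0 uu]]].
(* In characteristic 2 the square of [ad u] is [ad (u * u)], which equals [ad u]. *)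
have addid x : ad u (ad u x) = ad u x.
  rewrite [ad u x]ad_char2 ad_char2 mulrDl mulrDr !mulrA addrA.
  rewrite -[X in X + _]addrA char2A addr0.
  rewrite -[x * u * u]mulrA uu mulrDl mulrDr -scalerAl -scalerAr mul1r mulr1.
  by rewrite addrACA char2A addr0.
(* If all fixed points of [ad u] had square zero, any two would commute. Writing [x] as an element
   centralizing [u] plus a fixed point then gives [v * x * v = 0], against primeness. *)
have [v ev vv] : exists2 v, ad u v = v & v * v != 0.
  apply: contrapT => sq0.
  have {}sq0 v : ad u v = v -> v * v = 0.
    by move=> ev; apply/eqP; apply: contraT => vv; case: sq0; exists v.
  have anti v w : ad u v = v -> ad u w = w -> v * w = w * v.
    move=> ev ew; have := sq0 (v + w); rewrite linearD /= ev ew => /(_ erefl) /eqP.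
    by rewrite mulrDl !mulrDr !sq0 // add0r addr0 addr_eq0 char2_opp => /eqP.
  have /lfunPn[y] := u0; rewrite zero_lfunE; set v := ad u y => v0.
  have ev : ad u v = v by rewrite addid.
  have [x|/eqP|/eqP] := primeA (x := v) (y := v); rewrite ?(negPf v0) //.
  have -> : x = (x + ad u x) + ad u x by rewrite -addrA char2A addr0.
  have cx : ad u (x + ad u x) = 0 by rewrite linearD /= addid char2A.
  have e2 : ad u (v * (x + ad u x)) = v * (x + ad u x).
    by rewrite ad_mul cx mulr0 addr0 ev.
  rewrite mulrDr mulrDl (anti (v * _) v) // mulrA sq0 // mul0r add0r.
  by rewrite (anti v (ad u x)) // -mulrA sq0 ?mulr0.
have cvv : ad u (v * v) = 0 by rewrite ad_mul ev char2A.
have [l [m el]] := centralizer_quadratic u0 cvv.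
have vn0 : v != 0 by apply: contraNneq vv => ->; rewrite mul0r.
(* Otherwise [u] would be a combination of [1] and [v * v], so it would commute with [v], and
   [v = ad u v] would vanish. *)
have m0 : m = 0.
  apply: contraNeq vn0 => m0; apply/eqP/(scalerI m0).
  rewrite scaler0 -ev -adZl.
  have -> : m *: u = v * v - l%:A by rewrite el addrC addKr.
  by rewrite adDl -scaleNr ad_scalar addr0 adE mulrA subrr.
rewrite {}m0 scale0r addr0 in el.
have l0 : l != 0 by apply: contraNneq vv => l0; rewrite el l0 scale0r.
exists u, v, k, l; split => // x.
(* Both [x + ad u x] and [ad u x * v] centralize [u]. Another factor [v] turns the latter into
   [l *: ad u x], hence the coefficients with [l^-1]. *)
have cx : ad u (x + ad u x) = 0 by rewrite linearD /= addid char2A.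
have [p [q epq]] := centralizer_quadratic u0 cx.
have civ : ad u (ad u x * v) = 0 by rewrite ad_mul addid ev char2A.
have [r [s ers]] := centralizer_quadratic u0 civ.
exists p, q, (l^-1 * r), (l^-1 * s).
have -> : x = (x + ad u x) + ad u x by rewrite -addrA char2A addr0.
rewrite epq -[_ + _ + _ + _]addrA; congr (_ + _).
apply: (scalerI l0); rewrite scalerDr !scalerA !mulrA divff // !mul1r.
have -> : l *: ad u x = ad u x * (v * v) by rewrite el -scalerAr mulr1.
by rewrite mulrA ers mulrDl -!scalerAl mul1r.
Qed.

End PrimeAlgebra.

(** * Commutators in quaternion coordinates *)

Section QuaternionBasis.
Variables (F : fieldType) (A : falgType F) (u v : A) (l : F).
Hypothesis char2A : forall x : A, x + x = 0.
Hypothesis aduv : ad u v = v.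
Hypothesis vv : v * v = l%:A.
Hypothesis l0 : l != 0.
Hypothesis basis : forall x : A,
  exists p q r s, x = p%:A + q *: u + r *: v + s *: (u * v).

(** These are the quaternions of trace zero, which in characteristic 2 include the scalars;
    [ad_pure] and [pure_ad] identify them with the commutator subgroup. *)
Definition pure : {vspace A} := <<[:: 1; v; u * v]%R>>%VS.

Lemma pureP x :
  reflect (exists p r s, x = p%:A + r *: v + s *: (u * v)) (x \in pure).
Proof.
rewrite /pure !span_cons span_nil addv0; apply: (iffP idP).
  case/memv_addP=> a /vlineP[p ->] [b].
  case/memv_addP=> c /vlineP[r ->] [d /vlineP[s ->] ->] ->.
  by exists p, r, s; rewrite addrA.
by case=> p [r [s ->]]; rewrite -addrA !memv_add // memvZ ?memv_line.
Qed.

Lemma basis_ad : [/\ ad u (u * v) = u * v, ad v u = v, ad v (u * v) = l%:A,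
  ad (u * v) u = u * v & ad (u * v) v = l%:A].
Proof.
have aduuv : ad u (u * v) = u * v by rewrite ad_mul adxx mul0r add0r aduv.
have advu : ad v u = v by rewrite adC aduv (char2_opp char2A).
have advuv : ad v (u * v) = l%:A by rewrite ad_mul adxx mulr0 addr0 advu vv.
by split; rewrite // adC ?aduuv ?advuv (char2_opp char2A).
Qed.

Lemma ad_pure x y : ad x y \in pure.
Proof.
have [aduuv advu advuv aduvu aduvv] := basis_ad.
have [p [q [r [s ->]]]] := basis x; have [p' [q' [r' [s' ->]]]] := basis y.
rewrite !(adDl, adZl, linearD, linearZ) /= !(adxx, adx1, ad1x).
have v1 : 1 \in pure by apply: memv_span; rewrite !inE eqxx.
have vS : v \in pure by apply: memv_span; rewrite !inE eqxx orbT.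
have uvS : u * v \in pure by apply: memv_span; rewrite !inE eqxx !orbT.
rewrite aduv aduuv advu advuv aduvu aduvv.
by do ?[apply: memvD | apply: memvZ]; rewrite ?mem0v.
Qed.

(** The first commutator produces the scalar part from [ad v (u * v) = l]; the second produces the
    rest, which [ad u] fixes. *)
Lemma pure_ad x : x \in pure -> exists a b c d, x = ad a b + ad c d.
Proof.
have [aduuv _ advuv _ _] := basis_ad.
case/pureP=> p [r [s ->]].
exists v, ((p / l) *: (u * v)), u, (r *: v + s *: (u * v)).
by rewrite !(linearD, linearZ) /= advuv aduv aduuv scalerA divfK // addrA.
Qed.

(** Among [1], [v] and [u * v] only the last two fail to commute, and their commutator is the scalar
    [l]. *)
Lemma ad_pure_pure x y : x \in pure -> y \in pure -> ad x y \in 1%VS.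
Proof.
have [_ _ advuv _ aduvv] := basis_ad.
move=> /pureP[p [r [s ->]]] /pureP[p' [r' [s' ->]]].
rewrite !(adDl, adZl, linearD, linearZ) /=.
rewrite !(adxx, adx1, ad1x) advuv aduvv.
by do ?[apply: memvD | apply: memvZ]; rewrite ?mem0v ?memv_line.
Qed.

(** Modulo scalars the commutator is a nondegenerate alternating form on [pure]: [u * v] detects the
    coordinate at [v], and [v] the one at [u * v]. *)
Lemma pure_ad_eq1 x :
  x \in pure -> ad x != 0 -> exists2 y, y \in pure & ad x y = 1.
Proof.
have [_ _ advuv _ aduvv] := basis_ad.
move=> /pureP[p [r [s ->]]] x0.
have [r0|r0] := eqVneq r 0; last first.
  exists ((r * l)^-1 *: (u * v)).
    by apply/pureP; exists 0, 0, (r * l)^-1; rewrite !scale0r !add0r.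
  rewrite linearZ /= !adDl !adZl ad1x adxx !scaler0 advuv addr0 add0r.
  by rewrite !scalerA -mulrA mulVf ?scale1r ?mulf_neq0.
have s0 : s != 0.
  apply: contraNneq x0 => s0; apply/eqP/lfunP => y.
  by rewrite r0 s0 !scale0r !addr0 ad_scalar zero_lfunE.
exists ((s * l)^-1 *: v).
  by apply/pureP; exists 0, (s * l)^-1, 0; rewrite !scale0r add0r addr0.
rewrite linearZ /= !adDl !adZl ad1x adxx !scaler0 aduvv addr0 add0r.
by rewrite !scalerA -mulrA mulVf ?scale1r ?mulf_neq0.
Qed.

(** Modulo scalars [ad a] acts on [pure] as multiplication by the coordinate [q] of [a] at [u],
    which is nonzero outside [pure]. So [b] is the nonscalar part of [y] divided by [q]. *)
Lemma pure_sub_ad a y : a \notin pure -> y \in pure ->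
  exists2 b, b \in pure & y - ad a b \in 1%VS.
Proof.
have [aduuv _ advuv _ aduvv] := basis_ad.
have [p [q [r [s ->]]]] := basis a.
have [->|q0 _] := eqVneq q 0.
  by case/negP; apply/pureP; exists p, r, s; rewrite scale0r addr0.
case/pureP=> p' [r' [s' ->]].
exists (q^-1 *: (r' *: v + s' *: (u * v))).
  by apply/pureP; exists 0, (q^-1 * r'), (q^-1 * s');
    rewrite scale0r add0r scalerDr !scalerA.
rewrite -(addrA p'%:A); set w := r' *: v + _.
have adw : ad u w = w by rewrite !(linearD, linearZ) /= aduv aduuv.
rewrite linearZ /= !adDl ad_scalar add0r adZl adw.
rewrite -[in X in _ - X]addrA scalerDr scalerA.
rewrite mulVf // scale1r opprD addrA addrK /w !(adZl, linearD, linearZ) /=.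
rewrite !adxx advuv aduvv.
by do ?[apply: memvD | apply: memvZ]; rewrite ?memvN ?mem0v ?memvZ ?memv_line.
Qed.

(** If [v] were central, [v = ad v u] would be zero, against [v * v = l%:A] with [l] nonzero. *)
Lemma pure_nonscalar : v \in pure /\ ad v != 0.
Proof.
have [_ advu _ _ _] := basis_ad.
split; first by apply: memv_span; rewrite !inE eqxx orbT.
apply: contraNneq l0 => v0; have := vv.
rewrite -{1}advu v0 zero_lfunE mul0r => /esym/eqP.
by rewrite scaler_eq0 oner_eq0 orbF.
Qed.

End QuaternionBasis.

(** * Existence of a unit *)

Section PrimeSubalgebraUnit.
Variables (F : fieldType) (A : falgType F) (V : {vspace A}).
Hypothesis mulV : {in V &, forall x y, x * y \in V}.
Hypothesis primeV : {in V &, forall x y,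
  {in V, forall z, x * z * y = 0} -> x = 0 \/ y = 0}.

(** Primeness gives [x] and [y] in [L] with [y * x] nonzero. If [L * x] is smaller than [L],
    induction on the dimension applies to it. Otherwise right multiplication by [x] is bijective on
    [L], and the solution [e] of [e * x = x] is idempotent. *)
Lemma left_ideal_idempotent (L : {vspace A}) :
    (L <= V)%VS -> L != 0%VS -> {in V & L, forall x y, x * y \in L} ->
  exists e, [/\ e \in L, e != 0 & e * e = e].
Proof.
have [n] := ubnP (\dim L); elim: n L => // n IHn L ltn sLV L0 VL.
have [x [y [xL yL yx]]] : exists x y, [/\ x \in L, y \in L & y * x != 0].
  apply: contrapT => LL0; have xL := memv_pick L.
  have xV := subvP sLV _ xL; have zV := primeV xV xV.
  have : vpick L = 0.
    case: zV => // z zV; rewrite -mulrA; apply/eqP; apply: contraT => xzx.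
    by case: LL0; exists (z * vpick L), (vpick L); rewrite VL.
  by move/eqP; rewrite vpick0 (negPf L0).
have xV := subvP sLV _ xL.
pose Lx := (amulr x @: L)%VS.
have memLx z : z \in L -> z * x \in Lx.
  by move=> zL; apply/memv_imgP; exists z; rewrite // lfunE.
have LxP z : z \in Lx -> exists2 t, t \in L & z = t * x.
  by case/memv_imgP=> t tL ->; exists t; rewrite // lfunE.
have sLx : (Lx <= L)%VS.
  by apply/subvP=> z /LxP[t tL ->]; rewrite VL // (subvP sLV).
have [eqL|neL] := eqVneq Lx L; last first.
  have [|||a b aV /LxP[t tL ->]|e [eL e0 ee]] := IHn Lx.
  - rewrite -ltnS (leq_trans _ ltn) // ltnS ltn_neqAle dimvS // andbT.
    by apply: contra neL => d; rewrite eqEdim sLx (eqP d) leqnn.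
  - exact: subv_trans sLx sLV.
  - apply: contraNneq yx => Lx0.
    by have := memLx _ yL; rewrite Lx0 memv0.
  - by rewrite mulrA memLx // VL.
  by exists e; rewrite (subvP sLx).
have [e eL ex] : exists2 e, e \in L & x = e * x.
  by apply: LxP; rewrite eqL.
have x0 : x != 0 by apply: contraNneq yx => ->; rewrite mulr0.
exists e; split=> //.
  by apply: contraNneq x0 => e0; rewrite ex e0 mul0r.
have kerL : (L :&: lker (amulr x))%VS = 0%VS.
  apply/eqP; rewrite -dimv_eq0.
  have /eqP := limg_ker_dim (amulr x) L.
  by rewrite -/Lx eqL -{2}[\dim L]add0n eqn_add2r.
have : e * e - e \in (L :&: lker (amulr x))%VS.
  rewrite memv_cap memv_ker lfunE /= mulrBl -mulrA -!ex subrr eqxx andbT.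
  by rewrite memvB // VL // (subvP sLV).
by rewrite kerL memv0 subr_eq0 => /eqP.
Qed.

(** Idempotents are enlarged until the left annihilator of [e] in [V] is zero. It contains every
    [x - x * e], so [e] is a right unit, and primeness makes it two-sided. *)
Lemma prime_subalgebra_unit : V != 0%VS ->
  exists2 e, e \in V & {in V, forall x, x * e = x /\ e * x = x}.
Proof.
move=> V0.
have [e eV xe] : exists2 e, e \in V & {in V, forall x, x * e = x}.
  suff IH n e : e \in V -> e * e = e ->
      (\dim (V :&: lker (amulr e)) < n)%N ->
      exists2 e, e \in V & {in V, forall x, x * e = x}.
    (* The process starts from the idempotent 0, annihilated by all of [V]. *)
    exact: (IH _ 0 (mem0v _) (mulr0 _) (ltnSn _)).
  elim: n e => // n IHn e eV ee ltn; set L := (V :&: _)%VS in ltn.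
  have LP x : (x \in L) = (x \in V) && (x * e == 0).
    by rewrite memv_cap memv_ker lfunE.
  have [L0|L0] := eqVneq L 0%VS.
    exists e => // x xV; apply/esym/eqP; rewrite -subr_eq0 -memv0 -L0 LP.
    by rewrite mulrBl -mulrA ee subrr eqxx memvB // mulV.
  have [||f [fL f0 ff]] := left_ideal_idempotent _ L0; first exact: capvSl.
    move=> x y xV; rewrite !LP -mulrA => /andP[/(mulV xV)-> /eqP->].
    by rewrite mulr0 /=.
  have /andP[fV /eqP fe] : (f \in V) && (f * e == 0) by rewrite -LP.
  (* [e + f - e * f] is an idempotent with a smaller left annihilator. *)
  pose g := e + f - e * f.
  have gV : g \in V by rewrite memvB ?memvD // mulV.
  have ge : g * e = e by rewrite /g !mulrBl mulrDl ee -mulrA fe mulr0 subr0 addr0.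
  have gf : g * f = f by rewrite /g mulrBl mulrDl -mulrA ff addrAC subrr add0r.
  apply: (IHn g) => //; first by rewrite {2}/g mulrBr mulrDr mulrA ge gf.
  have sgL : (V :&: lker (amulr g) <= L)%VS.
    apply/subvP=> x; rewrite LP memv_cap memv_ker lfunE /= => /andP[-> /eqP xg].
    by rewrite -ge mulrA xg mul0r eqxx.
  rewrite -ltnS (leq_trans _ ltn) // ltnS ltn_neqAle dimvS // andbT.
  apply: contra f0 => d; have /eqP eqL : (V :&: lker (amulr g))%VS == L.
    by rewrite eqEdim sgL (eqP d) leqnn.
  have := fL; rewrite -eqL memv_cap memv_ker lfunE /= => /andP[_].
  by rewrite /g mulrBr mulrDr mulrA fe mul0r ff add0r subr0.
exists e => // x xV; split; first exact: xe.
(* Since [z * e = z] for [z] in [V], every [z * (e * x - x)] vanishes; a nonzero left factor brings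
   this into the form required by primeness. *)
have pV := memv_pick V; have yV : e * x - x \in V by rewrite memvB // mulV.
have [z zV|/eqP|/eqP] := primeV pV yV; last by rewrite subr_eq0 => /eqP.
  by rewrite mulrBr !mulrA -[_ * z * e]mulrA xe // subrr.
by rewrite vpick0 (negPf V0).
Qed.

End PrimeSubalgebraUnit.

(** * Simple rings and their quotients *)

Section CenterField.
Variable Q : nzRingType.

(** A boolean version of [unital_center], from which the center becomes a subtype carrying a ring
    structure. *)
Definition centralp : pred Q := fun c => `[< unital_center c >].

Lemma centralP c : reflect (unital_center c) (c \in centralp).
Proof. exact: asboolP. Qed.

Fact centralp_subring : subring_closed centralp.
Proof.
split=> [|c d /centralP cc /centralP cd|c d /centralP cc /centralP cd].
- by apply/centralP=> q; apply/commr_sym/commr1.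
- by apply/centralP=> q; apply/commr_sym/commrB; apply/commr_sym.
- by apply/centralP=> q; apply/commr_sym/commrM; apply/commr_sym.
Qed.

HB.instance Definition _ := GRing.isSubringClosed.Build Q centralp centralp_subring.

Record center_of := CenterOf { center_val : Q; _ : center_val \in centralp }.

HB.instance Definition _ := [isSub for center_val].
HB.instance Definition _ := [Choice of center_of by <:].
HB.instance Definition _ := [SubChoice_isSubNzRing of center_of by <:].

Fact center_mulC : commutative (@GRing.mul center_of).
Proof.
by move=> x y; apply: val_inj; rewrite !rmorphM; apply: (centralP _ (valP x)).
Qed.

HB.instance Definition _ :=
  GRing.PzRing_hasCommutativeMul.Build center_of center_mulC.

Lemma center_field :
    (forall c : Q, unital_center c -> c != 0 ->
       exists2 d, unital_center d & d * c = 1) ->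
  exists (F : fieldType) (j : {rmorphism F -> Q}),
    forall c, unital_center c <-> exists k, c = j k.
Proof.
move=> inv.
(* The inverse is a total function, chosen with value 0 at 0 as the field structure prescribes. *)
have /choice[i ip] : forall x : center_of, exists y : center_of,
    (x != 0 -> y * x = 1) /\ (x = 0 -> y = 0).
  move=> x; have [->|x0] := eqVneq x 0; first by exists 0.
  have [|d cd dx] := inv _ (centralP _ (valP x)).
    by apply: contraNneq x0 => x0; apply/eqP/val_inj; rewrite x0 rmorph0.
  exists (CenterOf (introT (centralP _) cd)); split=> [_|/eqP]; last first.
    by rewrite (negPf x0).
  by apply: val_inj; rewrite rmorphM rmorph1.
pose fieldM := GRing.ComNzRing_isField.Build center_of
  (fun x x0 => (ip x).1 x0) ((ip 0).2 erefl).
pose F : fieldType := HB.pack center_of fieldM.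
exists F, (val : {rmorphism center_of -> Q}) => c; split.
  by move=> cc; exists (CenterOf (introT (centralP _) cc)).
by case=> k ->; apply: (centralP _ (valP k)).
Qed.

End CenterField.

Section SimpleRing.
Local Open Scope rng_scope.
Variable R : rngType.
Implicit Types x y z : R.

Lemma rmul0r x : 0 ** x = 0.
Proof. by apply: (addrI (0 ** x)); rewrite -rmulDl !addr0. Qed.

Lemma rmulr0 x : x ** 0 = 0.
Proof. by apply: (addrI (x ** 0)); rewrite -rmulDr !addr0. Qed.

Lemma rmulNr x y : - x ** y = - (x ** y).
Proof. by apply/eqP; rewrite -addr_eq0 -rmulDl addNr rmul0r. Qed.

Lemma rmulrN x y : x ** - y = - (x ** y).
Proof. by apply/eqP; rewrite -addr_eq0 -rmulDr addNr rmulr0. Qed.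

Lemma rmulBl x y z : (x - y) ** z = x ** z - y ** z.
Proof. by rewrite rmulDl rmulNr. Qed.

Lemma rmulBr x y z : x ** (y - z) = x ** y - x ** z.
Proof. by rewrite rmulDr rmulrN. Qed.

Hypothesis simpleR : simple_ring R.

Lemma setT_neq0 : [set: R] <> [set 0].
Proof.
case: simpleR => -[x [y xy]] _ T0; apply: xy.
by have : [set: R] (x ** y) by []; rewrite T0.
Qed.

Lemma ideal_setT (I : set R) x : ideal I -> I x -> x != 0 -> I = setT.
Proof.
move=> idI Ix x0; case: (simpleR.2 I idI) => // I0.
by move: Ix x0; rewrite I0 /= => ->; rewrite eqxx.
Qed.

(** Such [x] form an ideal; were it all of [R], every product would vanish. *)
Lemma right_annihilator_eq0 x : (forall z, z ** x = 0) -> x = 0.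
Proof.
move=> Rx; apply/eqP; apply: contraT => x0.
have idI : ideal [set x | forall z, z ** x = 0].
  split=> [|r y yR]; last by split=> z; rewrite rmulA ?yR ?rmul0r.
  by split=> [z|y z yR zR w] /=; rewrite ?rmulr0 // rmulBr yR zR subrr.
have [[y [z yz]] _] := simpleR; case: yz.
have : [set: R] z by [].
by rewrite -(ideal_setT idI _ x0) //; apply.
Qed.

(** The [w] with [w ** z ** y = 0] for all [z] form an ideal. If it contains a nonzero [x] it is
    [R], and cancelling two arbitrary left factors leaves [y = 0]. *)
Lemma simple_ring_prime x y :
  (forall z, x ** z ** y = 0) -> x = 0 \/ y = 0.
Proof.
move=> xRy; have [->|x0] := eqVneq x 0; [by left|right].
have idI : ideal [set w | forall z, w ** z ** y = 0].
  split=> [|r w wR]; last first.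
    by split=> z; [rewrite -!rmulA (rmulA w) wR rmulr0 | rewrite -(rmulA w)].
  by split=> [z|v w vR wR z] /=; rewrite ?rmul0r // !rmulBl vR wR subrr.
apply: right_annihilator_eq0 => z; apply: right_annihilator_eq0 => w.
have : [set: R] w by [].
by rewrite -(ideal_setT idI _ x0) // rmulA; apply.
Qed.

End SimpleRing.

(** * The extended centroid of a simple ring *)

Section SymmetricQuotients.
Local Open Scope rng_scope.
Variables (R : rngType) (Q : nzRingType) (iota : {additive R -> Q}).
Hypothesis simpleR : simple_ring R.
Hypothesis quotQ : symmetric_quotient_ring iota.

Lemma iota_inj : injective iota. Proof. by case: quotQ => -[]. Qed.

Lemma iotaM x y : iota (x ** y) = iota x * iota y.
Proof. by case: quotQ => -[_ ->]. Qed.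

(** By simplicity the nonzero ideal that [q] multiplies into [R] is [R] itself; thus the image of
    [R] is an ideal of [Q]. *)
Lemma range_quotient_ideal q x :
  range iota (q * iota x) /\ range iota (iota x * q).
Proof.
case: quotQ => _ /(_ q)[J [idJ J0 HJ]] _ _; apply: HJ.
by case: (simpleR.2 J idJ) => [/J0//|->].
Qed.

Lemma quotient_eq0 q : (forall x, q * iota x = 0) -> q = 0.
Proof.
by case: quotQ => _ _ H _ q0; apply: (H q setT) => //;
  [apply: setT_neq0 | left].
Qed.

Lemma center_iota x : @center R x -> @unital_center Q (iota x).
Proof.
move=> cx q; apply/eqP; rewrite -subr_eq0; apply/eqP/quotient_eq0 => y.
have [[z _ ez] _] := range_quotient_ideal q y.
rewrite mulrBl -!mulrA -ez -!iotaM !cx !iotaM [in X in X - _]ez.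
by rewrite mulrA subrr.
Qed.

(** Multiplication by [c] on [R] has an ideal as kernel and as image, so it is bijective by
    simplicity. Its inverse [f] is a module map on both sides, and the compatible pair [(f, f)]
    defines the inverse of [c] in [Q]. *)
Lemma extended_centroid_inv (c : Q) : unital_center c -> c != 0 ->
  exists2 d, unital_center d & d * c = 1.
Proof.
move=> cc c0.
have qi x : exists y, iota y = c * iota x.
  by have [[y _ e] _] := range_quotient_ideal c x; exists y.
have c_inj x : c * iota x = 0 -> x = 0.
  move=> cx; apply/eqP; apply: contraT => x0; case/eqP: c0.
  have idI : ideal [set x | c * iota x = 0].
    split=> [|r y cy].
      split=> [|y z cy cz] /=; rewrite ?raddf0 ?mulr0 //.
      by rewrite raddfB mulrBr cy cz subrr.
    by split=> /=; rewrite iotaM mulrA ?cy ?mul0r // cc -mulrA cy mulr0.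
  apply: quotient_eq0 => y; have : [set: R] y by [].
  by rewrite -(ideal_setT simpleR idI cx x0).
have /choice[f ef] : forall x, exists y, c * iota y = iota x.
  move=> x; have : [set: R] x by [].
  have idI : ideal [set x | exists y, c * iota y = iota x].
    split=> [|r t [y ey]].
      split=> [|y z [y' ey] [z' ez]]; first by exists 0; rewrite !raddf0 mulr0.
      by exists (y' - z'); rewrite !raddfB mulrBr ey ez.
    split; last by exists (y ** r); rewrite !iotaM mulrA ey.
    by exists (r ** y); rewrite !iotaM -ey !mulrA cc.
  have [[y [z yz]] _] := simpleR.
  have [w0 w0P] : exists w, w != 0 :> R by exists (y ** z); apply/eqP.
  have [w ew] := qi w0.
  rewrite -(ideal_setT simpleR idI (x := w)) //; first by exists w0.
  by apply: contraNneq w0P => w00; apply/eqP/c_inj; rewrite -ew w00 raddf0.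
have cI x y : c * iota x = c * iota y -> x = y.
  move=> e; apply/eqP; rewrite -subr_eq0; apply/eqP/c_inj.
  by rewrite raddfB mulrBr e subrr.
have [q Hq] : exists q, forall x, q * iota x = iota (f x).
  have [_ _ _ ext] := quotQ.
  have [|||||q Hq] := ext setT f f => //.
  - exact: setT_neq0.
  - split=> [x y|x r] *; apply: cI; first by rewrite raddfD mulrDr !ef raddfD.
    by rewrite iotaM mulrA !ef iotaM.
  - split=> [x y|r x] *; apply: cI; first by rewrite raddfD mulrDr !ef raddfD.
    by rewrite ef !iotaM mulrA cc -mulrA ef.
  - move=> x y _ _; apply: cI; rewrite !iotaM [RHS]mulrA ef.
    by rewrite mulrA cc -mulrA ef.
  by exists q => x; case: (Hq x).
have cq : c * q = 1.
  apply/eqP; rewrite -subr_eq0; apply/eqP/quotient_eq0 => x.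
  by rewrite mulrBl -mulrA Hq ef mul1r subrr.
exists q; last by rewrite -cc.
move=> p; rewrite /GRing.comm -[LHS]mulr1 -{1}cq mulrA -(mulrA q) -(cc p).
by rewrite mulrA -(cc q) cq mul1r.
Qed.

Lemma central_closure_range : central_closure iota = range iota.
Proof.
have addI : additive_subgroup (range iota).
  split; first by exists 0; rewrite ?raddf0.
  by move=> _ _ [x _ <-] [y _ <-]; exists (x - y); rewrite ?raddfB.
apply/seteqP; split.
  apply: smallest_sub => // _ [r _ [c _ <-]].
  by case: (range_quotient_ideal c r).
move=> _ [r _ <-] S [_ HS]; apply: HS; exists r => //; exists 1; rewrite ?mulr1 //.
by move=> q; apply/commr_sym/commr1.
Qed.

End SymmetricQuotients.

(** * Exceptional simple rings as matrix algebras *)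

Lemma exceptional_algebra (R : rngType) : simple_ring R -> exceptional R ->
  exists (F : fieldType) (B : falgType F) (f : R -> B),
    [/\ injective f /\ (forall b, exists r, b = f r),
        {morph f : x y / x - y} /\ {morph f : x y / rmul x y >-> x * y},
        prime_alg B /\ central_alg B,
        (\dim {:B} <= 4)%N &
        forall b : B, b + b = 0].
Proof.
move=> simpleR [Q [iota [quotQ charR [e [Re_ gen ind]]]]].
rewrite (central_closure_range simpleR quotQ) in Re_ gen.
have iotaI := iota_inj quotQ; have iotaM := iotaM quotQ.
have [F [j jP]] := center_field (extended_centroid_inv simpleR quotQ).
have cj k q : j k * q = q * j k by apply: (jP (j k)).2; exists k.
(* [ph] will identify row vectors over [F] with the image of [R] in [Q]. *)
pose ph (x : 'rV[F]_4) := \sum_i j (x 0 i) * e i.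
have phD x y : ph (x + y) = ph x + ph y.
  by rewrite /ph -big_split; apply: eq_bigr => i _; rewrite !mxE rmorphD mulrDl.
have phB x y : ph (x - y) = ph x - ph y.
  by rewrite /ph -sumrB; apply: eq_bigr => i _; rewrite !mxE rmorphB mulrBl.
have phZ k x : ph (k *: x) = j k * ph x.
  by rewrite /ph mulr_sumr; apply: eq_bigr => i _; rewrite !mxE rmorphM mulrA.
have ph_sum (h : 'I_4 -> 'rV[F]_4) : ph (\sum_i h i) = \sum_i ph (h i).
  by apply: (big_morph ph phD); rewrite -(subrr 0) phB subrr.
have phI x y : ph x = ph y -> x = y.
  move/eqP; rewrite -subr_eq0 -phB => /eqP ph0.
  have c0 : forall i, j ((x - y) 0 i) = 0.
    by apply: ind => // i; apply/jP; exists ((x - y) 0 i).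
  apply/eqP; rewrite -subr_eq0; apply/eqP/rowP => i; apply: (fmorph_inj j).
  by rewrite c0 mxE rmorph0.
have ph_iota r : exists x, ph x = iota r.
  have [|c [cC ->]] := gen (iota r); first by exists r.
  have /choice[k ek] : forall i, exists k, c i = j k by move=> i; apply/jP.
  by exists (\row_i k i); apply: eq_bigr => i _; rewrite mxE ek.
have /choice[b eb] : forall i, exists r, iota r = e i.
  by move=> i; have [r _] := Re_ i; exists r.
have iota_ph x : exists r, iota r = ph x.
  have /choice[t et] : forall i, exists r, iota r = j (x 0 i) * e i.
    move=> i; rewrite -eb.
    have [[r _ er] _] :=
      range_quotient_ideal simpleR quotQ (j (x 0 i)) (b i).
    by exists r.
  by exists (\sum_i t i); rewrite raddf_sum; apply: eq_bigr.
(* [M r] is the matrix of right multiplication by [r]. *)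
have /choice[M MP] : forall r, exists X, forall x, ph (x *m X) = ph x * iota r.
  move=> r.
  have /choice[w ew] : forall i, exists x, ph x = e i * iota r.
    by move=> i; rewrite -eb -iotaM; apply: ph_iota.
  exists (\matrix_i w i) => x; rewrite mulmx_sum_row ph_sum mulr_suml.
  by apply: eq_bigr => i _; rewrite phZ rowK ew mulrA.
have Meq X Y : (forall x, ph (x *m X) = ph (x *m Y)) -> X = Y.
  by move=> e1; apply/row_matrixP => i; rewrite !rowE; apply/phI/e1.
have MB r s : M (r - s) = M r - M s.
  by apply: Meq => x; rewrite mulmxBr phB !MP raddfB mulrBr.
have MM r s : M (rmul r s) = M r * M s.
  by apply: Meq => x; rewrite -mulmxE mulmxA !MP iotaM mulrA.
(* An element acting as zero from the right on all of [R] is zero, so the matrix representation is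
   faithful. *)
have MI r s : M r = M s -> r = s.
  move=> e1; apply/eqP; rewrite -subr_eq0; apply/eqP.
  apply: (right_annihilator_eq0 simpleR) => y; apply: iotaI.
  have [x ex] := ph_iota y.
  by rewrite iotaM -ex -MP MB e1 subrr mulmx0 -(scale0r x) phZ rmorph0 mul0r raddf0.
have M0 : M 0 = 0 by rewrite -(subrr 0) MB subrr.
have MD r s : M (r + s) = M r + M s.
  by rewrite -[s in LHS]opprK MB -[- s]sub0r MB M0 sub0r opprK.
have MZ k r : exists s, M s = k *: M r.
  have [[s _ es] _] := range_quotient_ideal simpleR quotQ (j k) r.
  exists s; apply: Meq => x.
  by rewrite -scalemxAr phZ !MP es mulrA -cj mulrA.
pose X := [tuple M (b i) | i < 4]; pose V : {vspace 'M[F]_4} := <<X>>%VS.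
have MV r : M r \in V.
  have [x ex] := ph_iota r.
  have -> : M r = \sum_i x 0 i *: M (b i).
    apply: Meq => y; rewrite mulmx_sumr ph_sum MP -ex [ph x]/ph mulr_sumr.
    by apply: eq_bigr => i _; rewrite -scalemxAr phZ MP eb !mulrA cj.
  apply: memv_suml => i _; rewrite memvZ // memv_span //.
  by apply/tnthP; exists i; rewrite tnth_mktuple.
have VM v : v \in V -> exists r, v = M r.
  move=> /coord_span ->; elim/big_ind: _ => [|_ _ [r ->] [s ->]|i _].
  - by exists 0.
  - by exists (r + s).
  - rewrite -tnth_nth tnth_mktuple.
    by have [s es] := MZ (coord X i v) (b i); exists s; rewrite es.
have mulV : {in V &, forall x y, x * y \in V}.
  by move=> _ _ /VM[r ->] /VM[s ->]; rewrite -MM.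
have primeV : {in V &, forall x y,
    {in V, forall z, x * z * y = 0} -> x = 0 \/ y = 0}.
  move=> _ _ /VM[r ->] /VM[s ->] rs0.
  have [z|->|->] := @simple_ring_prime R simpleR r s; rewrite ?M0; auto.
  by apply: MI; rewrite !MM M0 rs0.
have V0 : V != 0%VS.
  have [[y [z yz]] _] := simpleR; apply: contra_not_neq yz => V0.
  by apply: MI; rewrite M0; apply/eqP; rewrite -memv0 -V0.
have [u uV u1] := prime_subalgebra_unit mulV primeV V0.
have algV : is_aspace V.
  apply/andP; split; last by apply/prodvP.
  apply/has_algidP; exists u; split=> //; last by move=> x /u1[].
  apply: contraNneq V0 => u0; rewrite -subv0; apply/subvP=> x /u1[<- _].
  by rewrite u0 mulr0 mem0v.
pose B := ASpace algV.
exists F, (subvs_of B), (fun r => Subvs (MV r)); split.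
- split=> [r s /(congr1 val)/MI //|v].
  by have [r er] := VM _ (valP v); exists r; apply: val_inj.
- by split=> r s; apply: val_inj; rewrite /= ?MB ?MM.
- split=> [x y xBy|z cz].
    have [z zV|x0|y0] := primeV _ _ (valP x) (valP y).
    + exact: (congr1 val (xBy (Subvs zV))).
    + by left; apply: val_inj.
    + by right; apply: val_inj.
  have [r er] := VM _ (valP z).
  have cr : @center R r.
    by move=> s; apply: MI; rewrite !MM -er; apply: (congr1 val (cz (Subvs (MV s)))).
  have [k ek] := (jP _).1 (center_iota simpleR quotQ cr); exists k.
  (* A central [r] acts as a scalar [k] of the extended centroid. The unit of [B] is [u], not by
     definition the identity matrix, so [z] is recovered as [z * u = k *: u]. *)
  have Mk : M r = k%:M.
    by apply: Meq => x; rewrite MP ek -cj -phZ mul_mx_scalar.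
  have [zu _] := u1 _ (valP z); have [a1 _] := u1 _ (memv_algid B).
  have ua : algid B = u by rewrite -a1 algidl.
  by apply: val_inj; rewrite /= ua -[LHS]zu er Mk -mulmxE mul_scalar_mx.
- by rewrite dimvf /dim /= (leq_trans (dim_span _)) ?size_tuple.
- move=> y; have [r er] := VM _ (valP y).
  apply: val_inj; rewrite /= er -MD -mulr2n.
  by rewrite ((charR 2).2 _ r) // M0.
Qed.

(** * Additive subgroups stable under commutation with [[R, R]] *)

Section AdditiveClosure.
Variable V : zmodType.

Lemma additive_closure_subgroup (S : set V) :
  additive_subgroup (additive_closure S).
Proof.
by split=> [T [[]]|x y Sx Sy T [T_ ST]] //; apply: T_.2; [apply: Sx|apply: Sy].
Qed.

Lemma additive_subgroupD (S : set V) x y :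
  additive_subgroup S -> S x -> S y -> S (x + y).
Proof. by case=> S0 SB Sx Sy; rewrite -[y]opprK -[- y]sub0r; apply/SB/SB/Sy. Qed.

End AdditiveClosure.

Lemma Lie_commutator (R : rngType) (A B : set R) a b :
  A a -> B b -> Lie A B (rmul a b - rmul b a).
Proof.
move=> Aa Bb.
have: [set rmul a b - rmul b a | a in A & b in B] (rmul a b - rmul b a).
  by exists a => //; exists b.
exact: sub_gen_smallest.
Qed.

Theorem theoremA (R : rngType) (A : set R) :
  simple_ring R -> exceptional R ->
  additive_subgroup A -> ~ (A `<=` @center R) ->
  (Lie A (Lie [set: R] [set: R]) `<=` A <->
   (@center R `<=` A /\ A `<=` Lie [set: R] [set: R]) \/
   Lie [set: R] [set: R] `<=` A).
Proof.
move=> simpleR excR sgA ncA.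
have [F [B [f [[fI fS] [fB fM] [primeB centralB] dimB char2B]]]] :=
  exceptional_algebra simpleR excR.
have f0 : f 0 = 0 by rewrite -(subrr 0) fB subrr.
have fD x y : f (x + y) = f x + f y.
  by rewrite -[y in LHS]opprK fB -[- y]sub0r fB f0 sub0r opprK.
have fad x y : f (rmul x y - rmul y x) = ad (f x) (f y).
  by rewrite fB !fM adE.
have centerP z : @center R z <-> exists k, f z = k%:A.
  split=> [cz|[k ek] x].
    apply: centralB => b; have [x ->] := fS b.
    by rewrite -!fM cz.
  by apply/eqP; rewrite -subr_eq0; apply/eqP/fI; rewrite fad ek ad_scalar f0.
have center_ad z : ad (f z) = 0 -> @center R z.
  move=> ad0 x; apply/eqP; rewrite -subr_eq0; apply/eqP/fI.
  by rewrite fad ad0 zero_lfunE f0.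
have [s [As ncs]] : exists s, A s /\ ad (f s) != 0.
  apply: contrapT => nc; apply: ncA => z Az; apply: center_ad; apply/eqP.
  by apply: contraT => nz; case: nc; exists z.
have [|u [v [_ [l [_ aduv vv l0 basis]]]]] :=
    exists_quaternion_basis primeB dimB centralB char2B.
  by exists (f s).
have LieP y : Lie [set: R] [set: R] y <-> f y \in pure u v.
  split=> [|/(pure_ad char2B aduv vv l0)[a [b [c [d]]]]].
    move: y; apply: smallest_sub.
      by split=> [|x y] /=; rewrite ?f0 ?mem0v // fB; apply: memvB.
    by move=> _ [a _ [b _ <-]]; rewrite /= fad; apply: (ad_pure char2B aduv vv).
  have [[a' ->] [b' ->] [c' ->] [d' ->]] := And4 (fS a) (fS b) (fS c) (fS d).
  rewrite -!fad -fD => /fI ->.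
  apply: (@additive_subgroupD _ (Lie [set: R] [set: R])).
  - exact: additive_closure_subgroup.
  - exact: Lie_commutator.
  - exact: Lie_commutator.
split=> [LA|[[ZA AL]|LA]]; last 2 first.
(* Both factors lie in [[R, R]], so their commutator is scalar, hence central and in [A]. *)
- apply: smallest_sub => // _ [a Aa [b Lb <-]]; apply/ZA/centerP.
  apply/vlineP; rewrite fad.
  by apply: (ad_pure_pure char2B aduv vv); apply/LieP => //; apply: AL.
- apply: smallest_sub => // _ [a Aa [b _ <-]].
  by apply: LA; apply: Lie_commutator.
have LAc a b : A a -> f b \in pure u v -> A (rmul a b - rmul b a).
  by move=> Aa /LieP Lb; apply: LA; apply: Lie_commutator.
(* [A] is only an additive subgroup, so the scalar [k] is moved into the factor from [[R, R]]:
   [ad (f t) (k *: y) = k%:A]. *)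
have ZA t : A t -> f t \in pure u v -> ad (f t) != 0 -> @center R `<=` A.
  move=> At Pt nct z /centerP[k ek].
  have [y Py ty] := pure_ad_eq1 char2B aduv vv l0 Pt nct.
  have [b eb] := fS (k *: y).
  have -> : z = rmul t b - rmul b t by apply: fI; rewrite fad -eb linearZ /= ty.
  by apply: LAc; rewrite // -eb memvZ.
have [AL|] := pselect (A `<=` Lie [set: R] [set: R]).
  by left; split=> //; apply: (ZA s) => //; apply/LieP; exact: AL.
move=> /existsNP[a /not_implyP[Aa La]]; right=> y /LieP Py.
have {La} Pa : f a \notin pure u v by apply/negP => Pa; apply/La/LieP.
have sub_ad := pure_sub_ad char2B aduv vv basis Pa.
have [Pv adv] := pure_nonscalar char2B aduv vv l0.
have {}ZA : @center R `<=` A.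
  (* Some commutator of [a] with [[R, R]] agrees with [v] modulo scalars: a noncentral element of
     [A] inside [[R, R]], to which the previous [ZA] applies. *)
  have [b0 Pb /vlineP[k ek]] := sub_ad _ Pv; have [b eb] := fS b0.
  have At : A (rmul a b - rmul b a) by apply: LAc; rewrite // -eb.
  apply: (ZA _ At); rewrite fad; first exact: (ad_pure char2B aduv vv).
  rewrite -eb; apply: contraNneq adv => ad0.
  apply/eqP/lfunP => x; rewrite -(subrK (ad (f a) b0) v) ek adDl ad0.
  by rewrite ad_scalar add0r.
(* Likewise [y] differs from a commutator lying in [A] by a central element, which is now known to
   lie in [A]. *)
have [b0 Pb /vlineP[k ek]] := sub_ad _ Py; have [b eb] := fS b0.
have [z ez] := fS k%:A.
have -> : y = rmul a b - rmul b a + z.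
  by apply: fI; rewrite fD fad -ez -ek -eb addrC subrK.
apply: (additive_subgroupD sgA); first by apply: LAc; rewrite // -eb.
by apply/ZA/centerP; exists k.
Qed.
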